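(* Let $d$ be a negative integer and $e:=|d|$. If $1\leq k \leq |d|+3$, then the $k$-th coefficient (the coefficient of $x^k$) of the generating function $L_e(x,1)$ coincides with the Catalan number $C_k=\frac{1}{k+1}\binom{2k}{k}$.
   Context: A Dyck path is a lattice path in the first quadrant that starts at the origin, ends on the $x$-axis, and consists of steps $U=(1,1)$ and $D=(1,-1)$ (never going below the $x$-axis). Its semi-length is its number of $U$ steps. A valley is an occurrence of two consecutive steps $DU$; the level of a valley is the $y$-coordinate of its lowest point. Let $\nu=(\nu_1,\dots,\nu_k)$ be the levels of all valleys of $P$, listed from left to right. For $d\in\mathbb Z$, a Dyck path is called $d$-Dyck if it has at most one valley or if $\nu_{i+1}-\nu_i\ge d$ for all $1\le i<k$. For $d<0$ and $e=|d|$, $L_e(x,1)=\sum_{n\ge 1}r_d(n)x^n$, where $r_d(n)$ is the number of $d$-Dyck paths of semi-length $n$. *)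

(* Defs.v *)
From mathcomp Require Import all_boot all_order all_algebra.

Set Implicit Arguments.
Unset Strict Implicit.
Unset Printing Implicit Defensive.

Import Order.TTheory GRing.Theory Num.Theory.
Local Open Scope ring_scope.

Definition step : finType := bool.
Definition U : step := true.
Definition D : step := false.

Definition dy (s : step) : int := if s == U then 1 else -1.

(* A path is the sequence of its steps; both steps have x-increment 1, so the
   path visits exactly the points (i, height P i) with 0 <= i <= size P. *)
Definition height (P : seq step) (i : nat) : int := \sum_(s <- take i P) dy s.

Definition dyck (P : seq step) : bool :=
  all (fun i => 0 <= height P i) (iota 0 (size P).+1)
  && (height P (size P) == 0).

Definition semilength (P : seq step) : nat := count_mem U P.

(* i is the position of the D of an occurrence DU (positions start at 0). The
   defaults U and D of nth exclude positions reaching past the end of P. *)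
Definition is_valley (P : seq step) (i : nat) : bool :=
  (nth U P i == D) && (nth D P i.+1 == U).

Definition valleys (P : seq step) : seq nat :=
  [seq i <- iota 0 (size P) | is_valley P i].

(* The lowest point of the valley DU at position i is the one reached after
   its D step, that is, after i.+1 steps. *)
Definition valley_levels (P : seq step) : seq int :=
  [seq height P i.+1 | i <- valleys P].

(* sorted compares consecutive entries only, and holds for sequences with at
   most one entry. *)
Definition d_dyck (d : int) (P : seq step) : bool :=
  dyck P && sorted (fun a b : int => d <= b - a) (valley_levels P).

Lemma size_dyck (P : seq step) : dyck P -> size P = (semilength P).*2.
Proof.
case/andP=> _; rewrite /height take_size => /eqP.
have -> : \sum_(s <- P) dy s = (semilength P).*2%:Z - (size P)%:Z.
  elim: P => [|s P IH]; first by rewrite big_nil.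
  rewrite big_cons IH /semilength /= /dy.
  case: (s == U); rewrite ?add1n ?add0n ?doubleS !intS !opprD.
    by rewrite [RHS]addrACA subrr add0r addrA.
  by rewrite addrCA.
by move/eqP; rewrite subr_eq0 => /eqP [->].
Qed.

(* By size_dyck, the d-Dyck paths of semi-length n all have 2n steps, so
   nothing is lost by counting among tuples of that size. *)
Definition r (d : int) (n : nat) : nat :=
  #|[set P : n.*2.-tuple step | d_dyck d P && (semilength P == n)]|.

(* Formal power series in x, as coefficient sequences. *)
Definition fps (R : Type) : Type := nat -> R.
Definition coef_fps (R : Type) (f : fps R) (k : nat) : R := f k.

(* L_e(x, 1) = \sum_(n >= 1) r_d(n) x^n with d = - e; the sum starts at n = 1,
   so the constant coefficient is 0. *)
Definition L (e : nat) : fps rat :=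
  fun n => if (1 <= n)%N then (r (- e%:Z) n)%:R else 0.

Definition catalan (k : nat) : rat := (k.+1)%:R^-1 * ('C(2 * k, k))%:R.

(* Main.v *)
Require Import Defs.
From mathcomp Require Import all_boot all_order all_algebra.
From mathcomp Require Import zify.

Set Implicit Arguments.
Unset Strict Implicit.
Unset Printing Implicit Defensive.

Import Order.TTheory GRing.Theory Num.Theory.
Local Open Scope ring_scope.

(** Up to semi-length [e + 3] the condition on valleys is void, so that the
coefficient counts all Dyck paths.  Indeed a valley at level [a] that is
followed by another valley forces at least [a + 3] up steps: [a + 1] to reach
the height from which the first valley is entered, one that leaves the first
valley and one that leaves the second.  Hence [a <= e] when there are at most
[e + 3] up steps, and the level drops by at most [a <= e] from one valley to
the next, which is at a level at least 0 ([d_dyck_short]).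

Dyck paths are counted through the paths of length [n] from height [h] to
height 0 that stay nonnegative.  By the first-step recurrence, for
[n = h + 2m] there are
[C(n, m) - C(n, m - 1)] of them ([card_descent]); [n = 2k], [h = 0] gives the
Catalan number. *)

(** * Valleys of short Dyck paths *)

Lemma heightS (P : seq step) (i : nat) : (i < size P)%N ->
  height P i.+1 = height P i + dy (nth U P i).
Proof.
by move=> iP; rewrite /height (take_nth U iP) -cats1 big_cat big_seq1.
Qed.

Lemma height_le_ups (P : seq step) (i : nat) :
  height P i <= (count_mem U (take i P))%:Z.
Proof.
rewrite /height; elim: (take i P) => [|s Q IH]; first by rewrite big_nil.
rewrite big_cons -[s :: Q]cat1s count_cat /= addn0.
move: (\sum_(t <- Q) _) (count_mem U Q) IH => x c IH.
by rewrite /dy; case: (s == U) => /=; lia.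
Qed.

Lemma leq_ups_take (P : seq step) (i j : nat) : (i <= j)%N ->
  (count_mem U (take i P) <= count_mem U (take j P))%N.
Proof.
move=> ij; rewrite -(subnKC ij) takeD count_cat; exact: leq_addr.
Qed.

Lemma ups_takeS (P : seq step) (i : nat) : nth D P i == U ->
  count_mem U (take i.+1 P) = (count_mem U (take i P)).+1.
Proof.
move=> Ui; have iP : (i < size P)%N.
  by case: ltnP Ui => // Pi; rewrite nth_default.
by rewrite (take_nth D iP) -cats1 count_cat /= Ui !addn0 addn1.
Qed.

Lemma dyck_height_ge0 (P : seq step) (i : nat) : dyck P -> 0 <= height P i.
Proof.
case/andP=> /allP hP _; have [iP|Pi] := leqP i (size P).
  by apply: hP; rewrite mem_iota.
have -> : height P i = height P (size P).
  by rewrite /height take_size take_oversize // ltnW.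
by apply: hP; rewrite mem_iota /=.
Qed.

(** A valley that is not the last one is at a level at least 3 below the
semi-length. *)
Lemma valley_level_bound (P : seq step) (i j : nat) :
    is_valley P i -> is_valley P j -> (i < j)%N ->
  height P i.+1 + 3 <= (semilength P)%:Z.
Proof.
case/andP=> Di Ui /andP[Dj Uj] ij.
have iP : (i < size P)%N by case: ltnP Di => // Pi; rewrite nth_default.
have jP : (j < size P)%N by case: ltnP Dj => // Pj; rewrite nth_default.
(* Step [i + 1] goes up and step [j] goes down. *)
have ij1 : (i.+1 < j)%N.
  rewrite ltn_neqAle ij andbT; apply/eqP => eij.
  by move: Dj; rewrite (set_nth_default D) // -eij (eqP Ui).
have := heightS iP; rewrite (eqP Di) /dy /=.
have := height_le_ups P i; have := ups_takeS Ui; have := ups_takeS Uj.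
have := leq_ups_take P (leqnSn i).
have := @leq_ups_take P i.+2 j.+1 (leqW ij1).
have : (count_mem U (take j.+2 P) <= semilength P)%N.
  by rewrite /semilength -{2}(cat_take_drop j.+2 P) count_cat leq_addr.
lia.
Qed.

Lemma d_dyck_short (e : nat) (P : seq step) : (semilength P <= e + 3)%N ->
  d_dyck (- e%:Z) P = dyck P.
Proof.
move=> Pe; rewrite /d_dyck; case dP: (dyck P) => //=.
rewrite /valley_levels sorted_map.
(* Positions of valleys increase from left to right, so the bound is proved
   for all pairs of valleys and not only for consecutive ones. *)
apply: (@sub_in_sorted _ (is_valley P) ltn); last 2 first.
- exact: filter_all.
- apply: sorted_filter (iota_ltn_sorted _ _); exact: ltn_trans.
move=> i j Vi Vj /= ij.
have := valley_level_bound Vi Vj ij; have := dyck_height_ge0 j.+1 dP; lia.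
Qed.

(** * Counting Dyck paths *)

(** [descent h P]: the path [P], started at height [h], stays at height at
least 0 and ends at height 0. *)
Fixpoint descent (h : nat) (P : seq step) : bool :=
  match P, h with
  | [::], _ => h == 0%N
  | true :: Q, _ => descent h.+1 Q
  | false :: Q, h'.+1 => descent h' Q
  | false :: _, 0 => false
  end.

Lemma descentE (h : nat) (P : seq step) :
  descent h P = all (fun i => 0 <= h%:Z + height P i) (iota 0 (size P).+1)
                && (h%:Z + height P (size P) == 0).
Proof.
elim: P h => [|s P IH] h; first by rewrite /height /= big_nil addr0 andbT.
have hS i : h%:Z + height (s :: P) i.+1 = h%:Z + dy s + height P i.
  by rewrite /height /= big_cons addrA.
have h0 (Q : seq step) : height Q 0 = 0 by rewrite /height take0 big_nil.
rewrite -[iota 0 _]/(0%N :: iota (1 + 0) (size P).+1) iotaDl.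
rewrite -[size (s :: P)]/((size P).+1) hS -[0%N :: _]cat1s all_cat.
rewrite all_seq1 h0 addr0 le0z_nat andTb all_map.
rewrite (@eq_all _ _ (fun i => 0 <= h%:Z + dy s + height P i)); last first.
  by move=> i; rewrite /= add1n hS.
case: s {hS}.
  have -> : h%:Z + dy true = h.+1%:Z by rewrite /dy /=; lia.
  exact: IH.
case: h => [|h]; first by rewrite /= h0.
have -> : h.+1%:Z + dy false = h%:Z by rewrite /dy /=; lia.
exact: IH.
Qed.

Lemma dyckE (P : seq step) : dyck P = descent 0 P.
Proof.
by rewrite descentE /dyck add0r; congr andb; apply: eq_all => i; rewrite add0r.
Qed.

Lemma descent_size (h : nat) (P : seq step) : descent h P -> (h <= size P)%N.
Proof.
by elim: P h => [|[] P IH] [|h] //= /IH // /ltnW /leqW.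
Qed.

Lemma card_tupleS (n : nat) (p : pred (seq bool)) :
  #|[set t : n.+1.-tuple bool | p t]| =
  (#|[set t : n.-tuple bool | p (true :: t)]|
   + #|[set t : n.-tuple bool | p (false :: t)]|)%N.
Proof.
have cons_inj b : injective (fun t : n.-tuple bool => cons_tuple b t).
  by move=> t u /(congr1 val) [] /val_inj.
rewrite -(card_imset _ (cons_inj true)) -(card_imset _ (cons_inj false)).
rewrite -cardsUI.
rewrite [X in (_ + X)%N]eq_card0 ?addn0; last first.
  move=> t; rewrite !inE; apply/negP => /andP[/imsetP[u _ ->] /imsetP[v _]].
  by move/(congr1 val).
apply: eq_card => t; rewrite !inE.
apply/idP/orP => [|[] /imsetP[u]]; last 2 first.
- by rewrite inE => pu ->.
- by rewrite inE => pu ->.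
case/tupleP: t => -[] t pt; [left|right]; apply/imsetP; exists t => //;
  by rewrite inE.
Qed.

(** The number of paths of length [n] from height [h] to height 0 that never go
below height 0. *)
Definition descents (n h : nat) : nat :=
  #|[set t : n.-tuple bool | descent h t]|.

Lemma descents_short (n h : nat) : (n < h)%N -> descents n h = 0%N.
Proof.
move=> nh; apply: eq_card0 => t; rewrite inE; apply/negP => /descent_size.
by rewrite size_tuple leqNgt nh.
Qed.

Lemma descentsS (n h : nat) : descents n.+1 h =
  (descents n h.+1 + if h is h'.+1 then descents n h' else 0)%N.
Proof.
rewrite /descents card_tupleS /=; congr (_ + _)%N; case: h => //.
by apply: eq_card0 => t; rewrite inE.
Qed.

(** The ballot numbers; [m] is the number of up steps.  The [if] stands for [C(n, m - 1)], which is 0 for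
[m = 0]. *)
Lemma card_descent (n h m : nat) : n = (h + m.*2)%N ->
  (descents n h + (if m is m'.+1 then 'C(n, m') else 0) = 'C(n, m))%N.
Proof.
elim: n h m => [|n IH] h m.
  move=> hm0; have [-> ->] : h = 0%N /\ m = 0%N by lia.
  rewrite bin0 addn0 /descents (eq_card (B := predT)) ?card_tuple //.
  by move=> t; rewrite inE tuple0.
rewrite descentsS; case: m => [|m] nE.
  have -> : h = n.+1 by lia.
  rewrite descents_short //.
  by have := IH n 0%N (esym (addn0 n)); rewrite !bin0.
have := IH h.+1 m ltac:(lia); case: h nE => [|h] nE.
  (* The binomials of an odd [n = 2m + 1] at [m] and [m + 1] agree. *)
  have := @bin_sub n m ltac:(lia); rewrite (_ : n - m = m.+1)%N; last lia.
  by case: m nE => [|m] nE; rewrite ?binS ?bin0; lia.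
have := IH h m.+1 ltac:(lia).
by case: m nE => [|m] nE; rewrite ?binS ?bin0; lia.
Qed.

Lemma catalanE (k : nat) : (descents k.*2 0)%:R = catalan k.
Proof.
have E : (k.+1 * descents k.*2 0 = 'C(2 * k, k))%N.
  rewrite mul2n; have := @card_descent k.*2 0 k erefl.
  case: k => [|k]; first by rewrite bin0; lia.
  (* [(k + 1) C(2k + 2, k + 1) = (k + 2) C(2k + 2, k)] *)
  have := mul_bin_left (k.+1.*2) k.
  rewrite (_ : k.+1.*2 - k = k.+2)%N; last lia.
  nia.
by rewrite /catalan -E natrM mulKf // pnatr_eq0.
Qed.

Lemma r_short (e k : nat) : (k <= e + 3)%N -> r (- e%:Z) k = descents k.*2 0.
Proof.
move=> ke; apply: eq_card => t; rewrite !inE -dyckE.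
apply/andP/idP => [[/andP[]] //|dt].
have sk : semilength t = k.
  by apply: double_inj; rewrite -size_dyck // size_tuple.
by rewrite d_dyck_short ?sk.
Qed.

Theorem theorem2p2 (d : int) (k : nat) (hd : d < 0)
    (hk1 : (1 <= k)%N) (hk2 : (k <= `|d| + 3)%N) :
  coef_fps (L `|d|%N) k = catalan k.
Proof.
by rewrite /coef_fps /L hk1 r_short // catalanE.
Qed.
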